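(* Let $K$ be a field of characteristic zero, $x$ a free variable, $I$ an ideal of $K[x]$, and $\delta$ a $K$-derivation or $K$-$\mathcal{E}$-derivation of $K[x]$. Then $\delta(I)$ is a Mathieu subspace of $K[x]$ if one of the following conditions holds: 1) $\delta$ is a locally nilpotent $K$-derivation of $K[x]$; 2) $\delta=\mathrm{id}-\phi$ for some $K$-algebra endomorphism $\phi$ of $K[x]$ with $\deg\phi(x)\ge 2$; 3) $\delta=\mathrm{id}-\phi$ for some $K$-algebra endomorphism $\phi$ of $K[x]$ with $\phi(x)=x+c$ for some $c\in K$, and $I=uK[x]$ where either $u=0$, or $\deg u\le 1$, or $u$ has at least one repeated root in the algebraic closure of $K$.
   Context: $\mathrm{id}$ denotes the identity map of $K[x]$. A $K$-linear map $\eta$ is locally nilpotent if for each $a$ there is $m\ge1$ with $\eta^m(a)=0$. A $K$-derivation $D$ of $K[x]$ is a $K$-linear map with $D(fg)=D(f)g+fD(g)$. A $K$-$\mathcal{E}$-derivation of $K[x]$ is a map of the form $\mathrm{id}-\phi$ with $\phi$ a $K$-algebra endomorphism of $K[x]$. A $K$-subspace $V$ of a commutative $K$-algebra $\mathcal{A}$ is a Mathieu subspace if for all $a,b\in\mathcal{A}$ with $a^m\in V$ for all $m\ge 1$, one has $a^mb\in V$ for all $m\gg 0$. *)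

(* Defs.v *)
From mathcomp Require Import all_boot all_order all_algebra.
Set Implicit Arguments. Unset Strict Implicit. Unset Printing Implicit Defensive.
Import GRing.Theory.
Local Open Scope ring_scope.

Section Defs.
Variable K : fieldType.
Local Notation P := {poly K}.

Definition is_ideal (I : P -> Prop) : Prop :=
  [/\ I 0, (forall a b, I a -> I b -> I (a + b)) & (forall a r, I a -> I (r * a))].

Definition image_of (delta : P -> P) (I : P -> Prop) : P -> Prop :=
  fun b => exists2 a, I a & b = delta a.

(* Mathieu subspace (the subspace property is assumed/provided separately) *)
Definition mathieu_subspace (V : P -> Prop) : Prop :=
  forall a b : P, (forall m : nat, (1 <= m)%N -> V (a ^+ m)) ->
    exists N : nat, forall m : nat, (N <= m)%N -> V (a ^+ m * b).

Definition K_linear (delta : P -> P) : Prop :=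
  forall (k : K) (p q : P), delta (k *: p + q) = k *: delta p + delta q.

Definition K_derivation (delta : P -> P) : Prop :=
  K_linear delta /\ forall f g : P, delta (f * g) = delta f * g + f * delta g.

Definition locally_nilpotent (delta : P -> P) : Prop :=
  forall a : P, exists2 m : nat, (1 <= m)%N & iter m delta a = 0.

Definition has_repeated_root (u : P) : Prop :=
  exists (L : closedFieldType) (f : {rmorphism K -> L}) (z : L),
    ('X - z%:P) ^+ 2 %| map_poly f u.
End Defs.

(* Main.v *)
From HB Require Import structures.
Require Import Defs.
From mathcomp Require Import all_boot all_order all_algebra all_field cyclic.
From mathcomp Require Import boolp classical_sets.
From mathcomp Require Import ring zify.
Import GRing.Theory.
Local Open Scope ring_scope.
Set Implicit Arguments.
Unset Strict Implicit.
Unset Printing Implicit Defensive.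

(** Unless the image is an ideal, it contains all positive powers of a only for a = 0.

    If deg phi(x) = e >= 2 and a^m = g_m - phi(g_m) for all m, then the power sums of a, phi(a), ...,
    phi^(N-1)(a) are divisible by phi^N(x) - x; by Newton's identities so is a^N, and e^N > N deg a for
    large N.

    A locally nilpotent derivation is c d/dx.  If the generator u of I is a power of a linear form, the image
    of I is an ideal.  Otherwise u has two roots r <> s in an extension, and the integral of a^m from r to s
    vanishes for all m.  For id - phi with phi(x) = x + c and a double root of u, the vanishing functional is
    instead the derivative at 0 of the indefinite sum of a^m.  In both cases one picks a large prime p and a
    valuation ring of the extension field whose maximal ideal contains p, rescales a to have integral
    coefficients that are not all in the maximal ideal, and contradicts this by reducing the identities for
    suitable powers a^m. *)

(** * Natural numbers in a field of characteristic zero *)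

Section CharZero.
Variable L : fieldType.
Hypothesis charL : [pchar L] =i pred0.

Lemma natr_eq0_char0 (n : nat) : (n%:R == 0 :> L) = (n == 0)%N.
Proof. by have /pcharf0P -> := charL. Qed.

Lemma natr_inj_char0 (m n : nat) : m%:R = n%:R :> L -> m = n.
Proof.
wlog: m n / (m <= n)%N => [H E|le_mn E].
  by case: (leqP m n) => h; [exact: H | symmetry; apply: H => //; exact: ltnW].
have: (n - m)%:R == 0 :> L by rewrite natrB // E subrr.
by rewrite natr_eq0_char0 ?addn1 //; lia.
Qed.

Lemma natrV_neq_int (p : nat) (n : int) : (1 < p)%N -> (p%:R)^-1 != n%:~R :> L.
Proof.
move=> p_gt1; have p0 : p%:R != 0 :> L by rewrite natr_eq0_char0 ?addn1 //; lia.
apply/eqP => E; have {}E : n%:~R * p%:R = 1 :> L by rewrite -E mulVf.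
case: n E => n.
  by rewrite -pmulrn -natrM => /(@natr_inj_char0 _ 1) /eqP; rewrite muln_eq1; lia.
rewrite NegzE mulrNz -pmulrn mulNr -natrM => E.
have /eqP: (n.+1 * p + 1)%N%:R = 0 :> L by rewrite natrD -[X in X + _]opprK E addNr.
by rewrite natr_eq0_char0 addn1.
Qed.
End CharZero.

(** * Existence of valuation rings above a prime *)

Section Place.
Variable L : fieldType.

(** A valuation ring with its maximal ideal, given as subsets of [L] so that no value group has to
    be built. By [vringV], elements of [vring] outside [vmax] are units. *)
Record place := Place {
  vring : subringClosed L;
  vmax : zmodClosed L;
  vmaxS : {subset vmax <= vring};
  vmaxM : forall x y, x \in vring -> y \in vmax -> x * y \in vmax;
  vmax1 : 1 \notin vmax;
  vringV : forall x, x \notin vring -> x^-1 \in vmax }.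

(* Clearing denominators between a relation for x and a relation for x^-1 lowers the degree of the longer one. *)
Lemma shorten_relation (A : subringClosed L) (t x : L) (q r : {poly L}) :
  t \in A -> t^-1 \notin A -> t != 0 ->
  (forall y, y \in A -> 1 - t * y != 0 /\ (1 - t * y)^-1 \in A) ->
  x != 0 -> q \is a polyOver A -> r \is a polyOver A ->
  q.[x] = t^-1 -> r.[x^-1] = t^-1 -> (size r <= size q)%N ->
  exists2 q' : {poly L}, q' \is a polyOver A /\ q'.[x] = t^-1 & (size q' < size q)%N.
Proof.
move=> tA tVA t0 unitA x0 qA rA qx rx le_rq.
have [n size_q] : exists n, size q = n.+1.
  case E: (size q) => [|n]; last by exists n.
  have q0 : q = 0 by apply/size_poly_leq0P; rewrite E.
  by move/eqP: qx; rewrite q0 horner0 eq_sym invr_eq0 (negPf t0).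
have [u0 uA] := unitA _ (polyOverP rA 0).
(* The relation [t * r.[x^-1] = 1], multiplied by [x ^+ n], can be solved for [x ^+ n] because one
   minus [t] times the constant coefficient of [r] is a unit. The solution [h], of degree below [n],
   replaces the leading power in [q]. *)
pose s := t / (1 - t * r`_0).
pose h : {poly L} := \sum_(1 <= i < n.+1) (s * r`_i) *: 'X^(n - i).
have hA : h \is a polyOver A.
  apply: rpred_sum => i _; apply: polyOverZ; last by rewrite rpredX ?polyOverX.
  by apply: rpredM (polyOverP rA i); apply: rpredM.
have hx : h.[x] = x ^+ n.
  have rE : r.[x^-1] = \sum_(0 <= i < n.+1) r`_i * x^-1 ^+ i.
    rewrite big_mkord (horner_coef_wide (n := n.+1)) ?size_q //.
    by rewrite -size_q.
  have E1 : 1 - t * r`_0 = t * \sum_(1 <= i < n.+1) r`_i * x^-1 ^+ i.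
    move: rE; rewrite rx big_ltn // expr0 mulr1 => E.
    by rewrite -(mulfV t0) {1}E mulrDr; ring.
  have -> : h.[x] = x ^+ n * (s * \sum_(1 <= i < n.+1) r`_i * x^-1 ^+ i).
    rewrite /h horner_sum !mulr_sumr.
    apply: eq_big_nat => i /andP[i1 i2].
    rewrite hornerZ hornerXn exprVn expfB_cond; last by rewrite (negPf x0); lia.
    by ring.
  by rewrite /s mulrAC -E1 divff // mulr1.
exists (q - q`_n *: 'X^n + q`_n *: h).
  split.
    rewrite rpredD ?rpredB ?polyOverZ ?rpredX ?polyOverX ?(polyOverP qA) //.
  by rewrite !(hornerD, hornerN, hornerZ) hornerXn hx qx subrK.
rewrite size_q ltnS; apply/leq_sizeP => j le_nj.
rewrite coefD coefB !coefZ coefXn.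
have -> : h`_j = 0.
  rewrite coef_sum big_nat big1 // => i /andP[i1 i2].
  by rewrite coefZ coefXn; case: eqP => [e|_]; [lia | rewrite mulr0].
have [->|ne] := eqVneq j n; first by rewrite mulr1 subrr mulr0 addr0.
by rewrite nth_default ?size_q ?mulr0 ?subr0 ?addr0 // ltn_neqAle eq_sym ne.
Qed.

(** Infinite descent on the total size of [q] and [r]: the longer relation can always be shortened,
    with [x] and [x^-1] exchanged when it is [r]. *)
Lemma valuation_alternative (A : subringClosed L) (t : L) :
  t \in A -> t^-1 \notin A -> t != 0 ->
  (forall y, y \in A -> 1 - t * y != 0 /\ (1 - t * y)^-1 \in A) ->
  forall (n : nat) (x : L) (q r : {poly L}), x != 0 ->
  q \is a polyOver A -> r \is a polyOver A ->
  q.[x] = t^-1 -> r.[x^-1] = t^-1 -> (size q + size r <= n)%N -> False.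
Proof.
move=> tA tVA t0 unitA; elim=> [|n IHn] x q r x0 qA rA qx rx le_n.
  have q0 : q = 0 by apply/size_poly_leq0P; lia.
  by move/eqP: qx; rewrite q0 horner0 eq_sym invr_eq0 (negPf t0).
case: (leqP (size r) (size q)) => [le_rq|/ltnW le_qr].
  have [q' [q'A q'x] lt_q] := shorten_relation tA tVA t0 unitA x0 qA rA qx rx le_rq.
  by apply: (IHn x q' r) => //; lia.
have [|//|r' [r'A r'x] lt_r] := shorten_relation tA tVA t0 unitA _ rA qA rx _ le_qr.
- by rewrite invr_eq0.
- by rewrite invrK.
by apply: (IHn x q r') => //; lia.
Qed.

(** Zorn's lemma applies since the union of a nonempty chain of subrings avoiding [w] is again
    one. *)
Lemma maximal_subring (S : subringClosed L) (w : L) : w \notin S ->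
  exists A : subringClosed L, [/\ {subset S <= A}, w \notin A &
    forall B : subringClosed L, {subset A <= B} -> w \notin B -> {subset B <= A}].
Proof.
move=> wS.
pose mem_of (X : set L) : {pred L} := fun x => `[< X x >].
have mem_ofE X x : (x \in mem_of X) = `[< X x >] by [].
pose good (X : set L) := subring_closed (mem_of X) /\ {subset S <= mem_of X} /\ ~ X w.
pose P (X : set L) := X = set0 \/ good X.
have [|X [PX maxX]] := @Zorn_bigcup L P.
  move=> F FP totF; have [[X0 [FX0 nX0]]|noX] := pselect (exists X, F X /\ X <> set0); last first.
    left; apply/seteqP; split=> // x [X FX Xx]; case: noX; exists X; split=> // X0.
    by move: Xx; rewrite X0.
  have goodF X x : F X -> X x -> good X.
    by move=> FX Xx; case: (FP X FX) => // E; move: Xx; rewrite E.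
  have [x0 X0x0] : exists x, X0 x.
    by apply: contrapT => h; apply: nX0; apply/seteqP; split=> // x X0x; case: h; exists x.
  have [[one0 _ _] [S0 _]] := goodF _ _ FX0 X0x0.
  right; split; last split.
  - have pairF x y : x \in mem_of (\bigcup_(X in F) X)%classic ->
      y \in mem_of (\bigcup_(X in F) X)%classic ->
      exists X, [/\ F X, x \in mem_of X & y \in mem_of X].
      rewrite !mem_ofE => /asboolP[X FX Xx] /asboolP[Y FY Yy].
      by case: (totF X Y FX FY) => sub; [exists Y | exists X]; split=> //; apply/asboolP => //;
         exact: sub.
    split=> [|x y Hx Hy|x y Hx Hy].
    + by apply/asboolP; exists X0 => //; apply/asboolP.
    + have [X [FX Xx Xy]] := pairF _ _ Hx Hy.
      have [[_ sX _] _] := goodF _ _ FX (asboolW Xx).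
      by apply/asboolP; exists X => //; apply/asboolP; exact: sX.
    + have [X [FX Xx Xy]] := pairF _ _ Hx Hy.
      have [[_ _ sX] _] := goodF _ _ FX (asboolW Xx).
      by apply/asboolP; exists X => //; apply/asboolP; exact: sX.
  - by move=> x Sx; apply/asboolP; exists X0 => //; apply/asboolP; exact: S0.
  - by move=> [X FX Xw]; have [_ [_]] := goodF _ _ FX Xw; apply.
have goodS : good [set x | x \in S]%classic.
  have E : mem_of [set x | x \in S]%classic =i S by move=> x; rewrite mem_ofE asboolb.
  split; last by split=> [x|]; [rewrite E | exact/negP].
  by split=> [|x y|x y]; rewrite !E; [exact: rpred1 | exact: rpredB | exact: rpredM].
have [ringX [SX wX]] : good X.
  case: PX => // X0; case: (maxX [set x | x \in S]%classic); last by right.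
  rewrite X0; split=> // /(_ 1); apply; exact: rpred1.
pose A : subringClosed L := HB.pack (mem_of X) (GRing.isSubringClosed.Build L (mem_of X) ringX).
exists A; split=> [//||B AB wB x Bx]; first by apply/asboolP.
apply: contrapT => xA; case: (maxX [set x | x \in B]%classic); last first.
  right; have E : mem_of [set x | x \in B]%classic =i B by move=> y; rewrite mem_ofE asboolb.
  split; last by split=> [y /SX|]; [rewrite E; exact: AB | exact/negP].
  by split=> [|y z|y z]; rewrite !E; [exact: rpred1 | exact: rpredB | exact: rpredM].
split=> [y Xy|sub]; first by apply: AB; apply/asboolP.
by apply: xA; apply/asboolP; exact: sub.
Qed.

(** The values at [x] of polynomials over [A] form a subring properly containing [A], which by
    maximality contains [w]. *)
Lemma adjoin_reaches (A : subringClosed L) (w x : L) :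
  (forall B : subringClosed L, {subset A <= B} -> w \notin B -> {subset B <= A}) ->
  x \notin A -> exists2 q : {poly L}, q \is a polyOver A & q.[x] = w.
Proof.
move=> maxA xA; apply: contrapT => no_q.
pose S : {pred L} := fun y => `[< exists2 q : {poly L}, q \is a polyOver A & q.[x] = y >].
have SP y : reflect (exists2 q : {poly L}, q \is a polyOver A & q.[x] = y) (y \in S).
  exact: asboolP.
have ringS : subring_closed S.
  split=> [|y z /SP[q qA <-] /SP[r rA <-]|y z /SP[q qA <-] /SP[r rA <-]]; apply/SP.
  - by exists 1; [exact: rpred1 | exact: hornerC].
  - by exists (q - r); [exact: rpredB | rewrite hornerD hornerN].
  - by exists (q * r); [exact: rpredM | rewrite hornerM].
pose B : subringClosed L := HB.pack S (GRing.isSubringClosed.Build L S ringS).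
case/negP: xA; apply: (maxA B).
- by move=> y Ay; apply/SP; exists y%:P; [rewrite polyOverC | exact: hornerC].
- by apply/SP => /no_q.
- by apply/SP; exists 'X; [exact: polyOverX | exact: hornerX].
Qed.

Lemma one_sub_exp (A : subringClosed L) (t y : L) (n : nat) : t \in A -> y \in A ->
  exists2 y', y' \in A & (1 - t * y) ^+ n = 1 - t * y'.
Proof.
move=> tA yA; elim: n => [|n [y' y'A IHn]].
  by exists 0; [exact: rpred0 | rewrite expr0 mulr0 subr0].
exists (y + y' - t * y * y'); last by rewrite exprS IHn; ring.
by rewrite !(rpredB, rpredD, rpredM).
Qed.

(* A subring maximal among those avoiding 1/p is a valuation ring. *)
Theorem place_exists (p : nat) : [pchar L] =i pred0 -> (1 < p)%N ->
  exists V : place, p%:R \in vmax V.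
Proof.
move=> charL p_gt1; set t : L := p%:R.
have t0 : t != 0 by rewrite natr_eq0_char0 //; lia.
pose S0 : {pred L} := fun y => `[< exists n : int, n%:~R = y >].
have S0P y : reflect (exists n : int, n%:~R = y) (y \in S0) by exact: asboolP.
have ringS0 : subring_closed S0.
  split=> [|x y /S0P[m <-] /S0P[n <-]|x y /S0P[m <-] /S0P[n <-]]; apply/S0P.
  - by exists 1.
  - by exists (m - n); rewrite intrB.
  - by exists (m * n); rewrite intrM.
pose S : subringClosed L := HB.pack S0 (GRing.isSubringClosed.Build L S0 ringS0).
have [|A [_ tVA maxA]] := @maximal_subring S t^-1.
  by apply/S0P => -[n E]; have := natrV_neq_int charL n p_gt1; rewrite E eqxx.
have tA : t \in A by rewrite rpred_nat.
have unitA y : y \in A -> 1 - t * y != 0 /\ (1 - t * y)^-1 \in A.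
  move=> yA; have neq1 z : z \in A -> 1 - t * z != 0.
    move=> zA; apply: contraNneq tVA => /eqP; rewrite subr_eq0 eq_sym => /eqP tz.
    by rewrite -[t^-1]mulr1 -tz mulKf.
  split; first exact: neq1.
  apply: contrapT => /negP zA; have [q qA qz] := adjoin_reaches maxA zA.
  set z := (1 - t * y)^-1 in zA qz.
  have z0 : z != 0 by rewrite invr_eq0 neq1.
  (* Clearing [z] from [q.[z] = t^-1] with a power of [1 - t * y] puts [(1 - t * y') / t] in [A],
     and hence [t^-1]. *)
  have cA : z^-1 ^+ size q * q.[z] \in A.
    rewrite horner_coef mulr_sumr rpred_sum // => i _.
    rewrite mulrCA -[X in _ ^+ X * _](subnK (ltnW (ltn_ord i))) exprD -mulrA -exprMn mulVf // expr1n mulr1.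
    by rewrite rpredM ?(polyOverP qA) // rpredX // invrK rpredB ?rpredM ?rpred1.
  have [y' y'A E] := one_sub_exp (size q) tA yA.
  rewrite qz invrK E mulrC in cA.
  case/negP: tVA; rewrite -[t^-1](subrK y') rpredD //.
  by have -> : t^-1 - y' = t^-1 * (1 - t * y') by rewrite mulrBr mulr1 mulKf.
have altA x : x \notin A -> x^-1 \in A.
  move=> xA; apply: contrapT => /negP xVA.
  have [q qA qx] := adjoin_reaches maxA xA; have [r rA rx] := adjoin_reaches maxA xVA.
  have x0 : x != 0 by apply: contraNneq xA => ->; exact: rpred0.
  exact: (valuation_alternative tA tVA t0 unitA x0 qA rA qx rx (leqnn _)).
(* Zero and the nonunits of [A]; by [altA], an element whose inverse is outside [A] lies in [A]. *)
pose M : {pred L} := [pred x | (x == 0) || (x^-1 \notin A)].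
have MS x : x \in M -> x \in A.
  by case/orP => [/eqP->|/altA]; [exact: rpred0 | rewrite invrK].
have MM x y : x \in A -> y \in M -> x * y \in M.
  move=> xA; rewrite !inE; have [->|y0] := eqVneq y 0; first by rewrite mulr0 eqxx.
  have [->|x0] := eqVneq x 0; first by rewrite mul0r eqxx.
  rewrite mulf_eq0 (negPf x0) (negPf y0) /=; apply: contra => xyA.
  by have := rpredM xA xyA; rewrite invfM mulrA mulfV // mul1r.
have MN x : x \in M -> - x \in M.
  by rewrite -mulN1r; apply: MM; rewrite rpredN rpred1.
have MD x y : x \in M -> y \in M -> x + y \in M.
  have [->|x0] := eqVneq x 0; first by rewrite add0r.
  have [->|y0] := eqVneq y 0; first by rewrite addr0.
  (* One of [x / y] and [y / x] lies in [A], so the sum is a multiple of one of the two nonunits. *)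
  wlog xyA : x y x0 y0 / x / y \in A => [H xM yM|xM yM].
    have [|/altA] := boolP (x / y \in A) => [?|]; first exact: H.
    by rewrite invfM invrK mulrC addrC => ?; apply: H.
  have -> : x + y = (x / y + 1) * y by rewrite mulrDl mul1r mulfVK.
  by apply: MM => //; rewrite rpredD ?rpred1.
have zmodM : zmod_closed M by split=> [|x y xM yM]; [rewrite inE eqxx | apply: MD => //; exact: MN].
pose M' : zmodClosed L := HB.pack M (GRing.isZmodClosed.Build L M zmodM).
have M1 : 1 \notin M' by rewrite inE oner_eq0 invr1 rpred1.
have MV x : x \notin A -> x^-1 \in M'.
  by move=> xA; rewrite inE invrK xA orbT.
by exists (@Place A M' MS MM M1 MV); rewrite inE tVA orbT.
Qed.
End Place.

(** * Divisibility, residues and reduced degrees at a place *)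

Section PlaceTheory.
Variables (L : fieldType) (V : place L).
Local Notation A := (vring V).
Local Notation M := (vmax V).

Lemma vringV_unit x : x \in A -> x \notin M -> x^-1 \in A.
Proof. by move=> xA; apply: contraR => /vringV; rewrite invrK. Qed.

Lemma vmaxMr x y : x \in M -> y \in A -> x * y \in M.
Proof. by move=> xM yA; rewrite mulrC vmaxM. Qed.

Lemma vmax_mull x y : x \in A -> x \notin M -> x * y \in M -> y \in M.
Proof.
move=> xA xM xyM; have x0 : x != 0 by apply: contraNneq xM => ->; exact: rpred0.
by rewrite -(mulKf x0 y) vmaxM // vringV_unit.
Qed.

(** Of two nonzero elements one divides the other in the valuation ring, so a finite family has a
    member dividing all the others. *)
Lemma exists_dominant (s : seq L) : has (fun x => x != 0) s ->
  exists2 a, (a != 0) && (a \in s) & forall b, b \in s -> b / a \in A.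
Proof.
elim: s => //= x s IHs; have [s0 _|/negP s0 x0] := boolP (has (fun x => x != 0) s); last first.
  have {}x0 : x != 0 by case/orP: x0.
  exists x; first by rewrite x0 inE eqxx.
  move=> b; rewrite inE => /predU1P[->|bs]; first by rewrite mulfV ?rpred1.
  by have [->|b0] := eqVneq b 0; [rewrite mul0r rpred0 | case: s0; apply/hasP; exists b].
have [a /andP[a0 a_s] dom] := IHs s0.
have [xaA|xaA] := boolP (x / a \in A).
  exists a; first by rewrite a0 inE a_s orbT.
  by move=> b; rewrite inE => /predU1P[->|/dom].
have x0 : x != 0 by apply: contraNneq xaA => ->; rewrite mul0r rpred0.
exists x; first by rewrite x0 inE eqxx.
move=> b; rewrite inE => /predU1P[->|/dom baA]; first by rewrite mulfV ?rpred1.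
have -> : b / x = b / a * (x / a)^-1 by rewrite invf_div mulrA divfK.
by rewrite rpredM // (vmaxS (vringV xaA)).
Qed.

Lemma normalize_coefs (f : {poly L}) : f != 0 ->
  exists2 c, c != 0 & c *: f \is a polyOver A /\ exists i, (c *: f)`_i \notin M.
Proof.
move=> f0; have [|a /andP[a0 /(nthP 0)[i _ fi]] dom] := @exists_dominant f.
  apply/hasP; exists (lead_coef f); last by rewrite lead_coef_eq0.
  by rewrite lead_coefE mem_nth // prednK // size_poly_gt0.
exists a^-1; first by rewrite invr_eq0.
split; last by exists i; rewrite coefZ fi mulVf // vmax1.
apply/polyOverP => k; rewrite coefZ mulrC.
have [lt_k|le_k] := ltnP k (size f); first by rewrite dom // mem_nth.
by rewrite nth_default // mul0r rpred0.
Qed.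

Section Residue.
Variable p : nat.
Hypotheses (p_pr : prime p) (pM : p%:R \in M).

(** For [n] prime to [p], a Bezout relation would put 1 in the maximal ideal. *)
Lemma natr_vmax (n : nat) : (n%:R \in M) = (p %| n)%N.
Proof.
apply/idP/idP => [nM|/dvdnP[k ->]]; last by rewrite natrM vmaxM // rpred_nat.
apply: contraT => not_dvd; have n_gt0 : (0 < n)%N by case: n not_dvd {nM} => //; rewrite dvdn0.
case: (egcdnP p n_gt0) => u v E _.
have gcd1 : gcdn n p = 1%N by apply/eqP; rewrite gcdnC -/(coprime p n) prime_coprime.
have : (u * n)%:R - (v * p)%:R \in M by rewrite !natrM rpredB // vmaxM // rpred_nat.
by rewrite E gcd1 natrD addrC addKr (negPf (vmax1 V)).
Qed.

Lemma natrV_vring (n : nat) : ~~ (p %| n)%N -> (n%:R)^-1 \in A.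
Proof. by rewrite -natr_vmax; apply: vringV_unit; rewrite rpred_nat. Qed.
End Residue.

Section ReducedDegree.

(* The degree of f modulo vmax. *)
Definition reduced_degree (f : {poly L}) (j : nat) : Prop :=
  [/\ f \is a polyOver A, f`_j \notin M & forall k, (j < k)%N -> f`_k \in M].

Lemma reduced_degree_exists (f : {poly L}) i : f \is a polyOver A -> f`_i \notin M ->
  exists2 j, reduced_degree f j & (j < size f)%N.
Proof.
move=> fA fi; have fP k : f`_k \notin M -> (k < size f)%N.
  by apply: contraR; rewrite -leqNgt => /(nth_default _) ->; exact: rpred0.
have ex : exists k, f`_k \notin M by exists i.
have bnd k : f`_k \notin M -> (k <= size f)%N by move/fP; exact: ltnW.
case: (ex_maxnP ex bnd) => j fj maxj; exists j; last exact: fP.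
by split=> // k; apply: contraTT => /maxj; rewrite leqNgt.
Qed.

(** In the coefficient of index [i + j], every product but that of the two top residues has a factor
    in the maximal ideal, and this ideal is prime. *)
Lemma reduced_degreeM f g i j :
  reduced_degree f i -> reduced_degree g j -> reduced_degree (f * g) (i + j).
Proof.
move=> [fA fi fM] [gA gj gM]; have /polyOverP fA' := fA; have /polyOverP gA' := gA.
split; first exact: rpredM.
  have lt_i : (i < (i + j).+1)%N by lia.
  rewrite coefM (bigD1 (Ordinal lt_i)) //= addKn; apply/negP => H.
  have : f`_i * g`_j \in M.
    rewrite -[_ * _](addrK (\sum_(k < (i + j).+1 | k != Ordinal lt_i) f`_k * g`_(i + j - k))).
    apply: rpredB H _; apply: rpred_sum => k; rewrite -val_eqE /= => ki.
    have [lt_ik|le_ki] := ltnP i k; first by rewrite vmaxMr ?fM.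
    by rewrite vmaxM ?gM //; lia.
  by move/(vmax_mull (fA' i) fi); exact/negP.
move=> k lt_k; rewrite coefM rpred_sum // => l _.
have [lt_il|le_li] := ltnP i l; first by rewrite vmaxMr ?fM.
by rewrite vmaxM ?gM //; have := ltn_ord l; lia.
Qed.

Lemma reduced_degree_exp f j m : reduced_degree f j -> reduced_degree (f ^+ m) (m * j).
Proof.
move=> fj; elim: m => [|m IHm]; last by rewrite exprS mulSn; exact: reduced_degreeM.
split; [by rewrite expr0 rpred1 | by rewrite expr0 coef1 vmax1 |].
by move=> k; rewrite expr0 coef1 mul0n => /gtn_eqF ->; exact: rpred0.
Qed.
End ReducedDegree.
End PlaceTheory.

(** * Polynomials all of whose powers have vanishing integral *)

Section Moments.
Variable L : fieldType.
Hypothesis charL : [pchar L] =i pred0.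

Lemma integral_coefs (f G : {poly L}) (n : nat) : G^`() = f -> G.[1] = G.[0] ->
  (size f <= n)%N -> \sum_(k < n) f`_k / k.+1%:R = 0.
Proof.
move=> dG G01 le_n.
have GE k : G`_k.+1 = f`_k / k.+1%:R.
  by rewrite -dG coef_deriv -(mulr_natr G`_k.+1) mulfK // natr_eq0_char0.
have le_G : (size G <= n.+1)%N.
  apply/leq_sizeP => k; case: k => [|k] le_k; first by rewrite ltn0 in le_k.
  by rewrite GE nth_default ?mul0r // (leq_trans le_n le_k).
move/eqP: G01; rewrite (horner_coef_wide _ le_G) big_ord_recl expr0 mulr1 horner_coef0.
rewrite -subr_eq0 addrC addKr => /eqP; apply: etrans.
by apply: eq_bigr => k _; rewrite expr1n mulr1 GE.
Qed.

(** By Euler's theorem [j] divides [p ^ totient j - 1], and [m] is the quotient. For [j = 0], fixing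
    [m = 1] keeps the degree of the power under control. *)
Lemma prime_power_exponent (p j : nat) : prime p -> (j < p)%N ->
  exists m e : nat, [/\ (0 < m)%N, (p ^ e = m * j + 1)%N & j = 0%N -> m = 1%N].
Proof.
move=> p_pr lt_jp; case: (posnP j) => [->|j_gt0]; first by exists 1%N, 0%N.
have co : coprime p j by rewrite prime_coprime // gtnNdvd.
have pe : (1 < p ^ totient j)%N by rewrite -(exp1n (totient j)) ltn_exp2r ?totient_gt0 // prime_gt1.
have /eqP E := Euler_exp_totient co.
rewrite eqn_mod_dvd in E; last by lia.
case/dvdnP: E => m E; exists m, (totient j); split; [|lia|lia].
by case: m E => //; lia.
Qed.

(** The bound [k < p ^ e.+1] allows at most [e] factors [p] in [k], and [k < p ^ e] fewer than [e];
    the cofactor prime to [p] is a unit. *)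
Lemma ratio_prime_power (V : place L) (p e k : nat) : prime p -> p%:R \in vmax V ->
  (0 < k)%N -> (k < p ^ e.+1)%N ->
  (p ^ e)%:R / k%:R \in vring V /\ ((k < p ^ e)%N -> (p ^ e)%:R / k%:R \in vmax V).
Proof.
move=> p_pr pM k_gt0 lt_k; case: (pfactor_coprime p_pr k_gt0) => s co_s Ek.
set v := logn p k in Ek; have p_gt1 := prime_gt1 p_pr.
have s_gt0 : (0 < s)%N by case: s co_s Ek => //; rewrite mul0n => _ ?; lia.
have le_pv : (p ^ v <= k)%N by rewrite Ek leq_pmull.
have le_ve : (v <= e)%N.
  by rewrite -ltnS -(ltn_exp2l _ _ p_gt1); exact: leq_ltn_trans le_pv lt_k.
have -> : (p ^ e)%:R / k%:R = (p ^ (e - v))%:R * (s%:R)^-1 :> L.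
  have pv0 : (p ^ v)%:R != 0 :> L by rewrite natr_eq0_char0 // -lt0n expn_gt0 prime_gt0.
  by rewrite Ek -{1}(subnK le_ve) expnD !natrM invfM mulrACA mulrC mulfV // mul1r.
have sA : (s%:R)^-1 \in vring V.
  by apply: (natrV_vring p_pr) => //; rewrite -prime_coprime.
split=> [|lt_ke]; first by rewrite rpredM ?rpred_nat.
have lt_ve : (v < e)%N by rewrite -(ltn_exp2l _ _ p_gt1); exact: leq_ltn_trans le_pv lt_ke.
by rewrite vmaxMr // (natr_vmax p_pr) // -(subnSK lt_ve) expnS dvdn_mulr.
Qed.

(* With a place above a large prime p and f of degree j modulo the maximal ideal, choose m with m j + 1 = q a power
   of p: among the terms c_k/(k+1) of the integral of f^m, the one with k + 1 = q strictly dominates. *)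
Theorem moment_vanishing (f : {poly L}) :
  (forall m, (1 <= m)%N -> exists2 G : {poly L}, G^`() = f ^+ m & G.[1] = G.[0]) -> f = 0.
Proof.
move=> Hf; apply/eqP; apply: contraT => f0.
have [p lt_p p_pr] := prime_above (size f).
have [V pM] := place_exists charL (prime_gt1 p_pr).
have [c c0 [fA [i fi]]] := normalize_coefs V f0.
have [j jdeg lt_j] := reduced_degree_exists fA fi.
rewrite size_scale // in lt_j.
have [m [e [m_gt0 Eq j0]]] := prime_power_exponent p_pr (ltn_trans lt_j lt_p).
have [gA gj gM] := reduced_degree_exp m jdeg.
have [G dG G01] := Hf m m_gt0.
set g := (c *: f) ^+ m in gA gj gM.
have gE : g = c ^+ m *: f ^+ m by rewrite /g exprZn.
have Ed : size f = (size f).-1.+1 by rewrite prednK // size_poly_gt0.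
rewrite Ed in lt_p lt_j; set n := ((size f).-1 * m).+1.
have le_n : (size g <= n)%N.
  by rewrite gE (leq_trans (size_scale_leq _ _)) // size_poly_exp_leq.
have := @integral_coefs g (c ^+ m *: G) n; rewrite derivZ dG -gE !hornerZ G01.
move=> /(_ erefl erefl le_n) sum0.
have lt_mj : (m * j < n)%N by rewrite /n ltnS mulnC leq_mul2r; apply/orP; right; lia.
(* All denominators [k.+1] stay below [p ^ e.+1], so none has more than [e] factors [p]. *)
have lt_n : (n < p ^ e.+1)%N.
  rewrite /n expnS Eq; case: (posnP j) => [j00|j_gt0].
    by rewrite j0 // j00; lia.
  have : (m * (size f).-1 <= m * (p * j))%N by rewrite leq_mul2l; apply/orP; right; nia.
  rewrite mulnCA mulnDr muln1 [(m * _.-1)%N]mulnC; lia.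
have /polyOverP gA' := gA.
(* After scaling by [p ^ e], the term of index [m * j] has factor 1. Later terms have their
   coefficient in the maximal ideal, earlier ones their ratio. *)
case/negP: gj; have : \sum_(k < n) g`_k * ((p ^ e)%:R / k.+1%:R) = 0.
  transitivity ((p ^ e)%:R * \sum_(k < n) g`_k / k.+1%:R); last by rewrite sum0 mulr0.
  by rewrite mulr_sumr; apply: eq_bigr => k _; rewrite mulrCA.
have pe0 : (p ^ e)%:R != 0 :> L by rewrite natr_eq0_char0 // Eq addn1.
rewrite (bigD1 (Ordinal lt_mj)) //= -[X in _ / X%:R]addn1 -Eq mulfV // mulr1.
move/eqP; rewrite addr_eq0 => /eqP ->; rewrite rpredN rpred_sum // => k.
rewrite -val_eqE /= => kj; have lt_kn := ltn_ord k.
have [kA kM] := @ratio_prime_power V p e k.+1 p_pr pM isT (leq_ltn_trans lt_kn lt_n).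
have [lt|le] := ltnP (m * j) k; first by rewrite vmaxMr ?gM.
by rewrite vmaxM // kM // Eq; lia.
Qed.
End Moments.

(** * Falling factorials and the difference operator *)

Section FallingFactorial.
Variable R : comNzRingType.

(** The forward difference acts on these polynomials as the derivative acts on powers, which makes
    indefinite sums explicit. *)
Definition fall (k : nat) : {poly R} := \prod_(i < k) ('X - i%:R%:P).

Lemma fall0 : fall 0 = 1. Proof. exact: big_ord0. Qed.

Lemma fallS k : fall k.+1 = fall k * ('X - k%:R%:P).
Proof. exact: big_ord_recr. Qed.

Lemma fall_monic k : fall k \is monic.
Proof. by apply: monic_prod => i _; exact: monicXsubC. Qed.

Lemma size_fall k : size (fall k) = k.+1.
Proof.
elim: k => [|k IHk]; first by rewrite fall0 size_poly1.
by rewrite fallS size_Mmonic ?monicXsubC ?monic_neq0 ?fall_monic // IHk size_XsubC addn2.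
Qed.

Lemma fall_polyOver (A : subringClosed R) k : fall k \is a polyOver A.
Proof.
apply: rpred_prod => i _.
by rewrite rpredB ?polyOverX // polyOverC rpred_nat.
Qed.

Lemma fall_natr k n : (fall k).[n%:R] = (n ^_ k)%:R.
Proof.
elim: k => [|k IHk]; first by rewrite fall0 hornerC.
rewrite fallS hornerM IHk hornerXsubC ffactnSr natrM.
have [le_kn|lt_nk] := leqP k n; first by rewrite natrB.
by rewrite ffact_small // !mul0r.
Qed.

Lemma fall_succ k : fall k.+1 \Po ('X + 1) = ('X + 1) * fall k.
Proof.
elim: k => [|k IHk].
  by rewrite fallS !fall0 mul1r mulr1 comp_polyB comp_polyX comp_polyC subr0.
rewrite fallS comp_polyM IHk -mulrA; congr (_ * _).
by rewrite fallS comp_polyB comp_polyX comp_polyC -natr1 polyCD opprD addrACA subrr addr0.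
Qed.

Lemma fall_diff k : fall k.+1 \Po ('X + 1) - fall k.+1 = k.+1%:R *: fall k.
Proof.
rewrite fall_succ fallS mulrC -mulrBr opprB addrC addrA subrK.
by rewrite mulrC -mul_polyC -natr1 polyCD addrC.
Qed.

(** At 0 only the term differentiating the factor ['X] survives, leaving the product of the [-i] for
    [i] from 1 to [k]. *)
Lemma deriv_fall k : (fall k.+1)^`().[0] = (-1) ^+ k * (k`!)%:R.
Proof.
elim: k => [|k IHk].
  by rewrite fallS fall0 mul1r derivB derivX derivC subr0 hornerC mulr1.
rewrite fallS derivM hornerD !hornerM IHk derivB derivX derivC subr0 hornerXsubC hornerC.
by rewrite -[0]/(0%:R) fall_natr ffact0n mul0r addr0 factS natrM exprS; ring.
Qed.

(** Each [fall k] is monic with coefficients in [A], so leading terms are removed without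
    division. *)
Lemma fall_span (A : subringClosed R) (f : {poly R}) n : f \is a polyOver A ->
  (size f <= n)%N ->
  exists2 d : nat -> R, forall k, d k \in A & f = \sum_(k < n) d k *: fall k.
Proof.
elim: n f => [|n IHn] f fA le_f.
  by exists (fun=> 0) => [k|]; [exact: rpred0 | rewrite big_ord0; exact/size_poly_leq0P].
have fnA : f`_n \in A by exact: (polyOverP fA).
have [||d dA E] := IHn (f - f`_n *: fall n).
- by rewrite rpredB // polyOverZ // fall_polyOver.
- apply/leq_sizeP => k le_nk; rewrite coefB coefZ.
  have [->|ne_kn] := eqVneq k n.
    have := fall_monic n; rewrite monicE lead_coefE size_fall /= => /eqP ->.
    by rewrite mulr1 subrr.
  have lt_nk : (n < k)%N by rewrite ltn_neqAle eq_sym ne_kn.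
  rewrite [f`_k]nth_default ?[(fall n)`_k]nth_default ?mulr0 ?subr0 ?size_fall //.
  exact: leq_trans le_f lt_nk.
exists (fun k => if k == n then f`_n else d k) => [k|]; first by case: ifP.
rewrite big_ord_recr /= eqxx -[LHS](subrK (f`_n *: fall n)) E; congr (_ + _).
by apply: eq_bigr => k _; rewrite ltn_eqF.
Qed.
End FallingFactorial.

(** * Indefinite sums in the falling factorial basis *)

Section Differences.
Variable L : fieldType.
Hypothesis charL : [pchar L] =i pred0.

Lemma poly_vanishing_on_nat (H : {poly L}) : (forall n : nat, H.[n%:R] = 0) -> H = 0.
Proof.
move=> H0; apply: (@roots_geq_poly_eq0 _ H [seq n%:R | n <- iota 0 (size H)]).
- by apply/allP => x /mapP[n _ ->]; apply/rootP.
- by rewrite map_inj_uniq ?iota_uniq // => m n; exact: natr_inj_char0.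
- by rewrite size_map size_iota.
Qed.

(** The difference of the two sides is invariant under the unit shift and zero at 0, hence zero at
    every natural number. *)
Lemma antidifference (G : {poly L}) (d : nat -> L) n : G.[0] = 0 ->
  G - (G \Po ('X + 1)) = \sum_(k < n) d k *: fall L k ->
  G = - \sum_(k < n) (d k / k.+1%:R) *: fall L k.+1.
Proof.
move=> G0 dG; apply/eqP; rewrite -addr_eq0; apply/eqP.
set S := \sum_(k < n) _; set H := G + S.
have dS : S \Po ('X + 1) - S = \sum_(k < n) d k *: fall L k.
  rewrite [S \Po _]raddf_sum /= -sumrB; apply: eq_bigr => k _.
  rewrite comp_polyZ -scalerBr fall_diff scalerA divfK //.
  by rewrite natr_eq0_char0.
have HH : H \Po ('X + 1) = H.
  apply/eqP; rewrite -subr_eq0 /H comp_polyD opprD addrACA dS -dG.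
  by rewrite -(opprB G) addNr.
apply: poly_vanishing_on_nat; elim=> [|m IHm]; last first.
  by rewrite -natr1 -IHm -[in RHS]HH horner_comp !hornerE.
rewrite hornerD G0 add0r /S horner_sum big1 // => k _.
by rewrite hornerZ fall_natr ffact0n mulr0.
Qed.

Lemma double_zero_relation (G : {poly L}) (d : nat -> L) n : G.[0] = 0 -> G^`().[0] = 0 ->
  G - (G \Po ('X + 1)) = \sum_(k < n) d k *: fall L k ->
  \sum_(k < n) d k * ((-1) ^+ k * ((k`!)%:R / k.+1%:R)) = 0.
Proof.
move=> G0 G'0 dG; move/eqP: G'0; rewrite (antidifference G0 dG) derivN hornerN oppr_eq0.
rewrite raddf_sum horner_sum => /eqP; apply: etrans; apply: eq_bigr => k _ /=.
by rewrite derivZ hornerZ deriv_fall; ring.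
Qed.

(** The left side telescopes to [- G.[p%:R]], which the explicit antidifference evaluates. *)
Lemma sum_values (G f : {poly L}) (d : nat -> L) n p : G.[0] = 0 ->
  G - (G \Po ('X + 1)) = f -> f = \sum_(k < n) d k *: fall L k ->
  \sum_(x < p) f.[x%:R] = \sum_(k < n) d k * ((p ^_ k.+1)%:R / k.+1%:R).
Proof.
move=> G0 dG fE; have -> : \sum_(x < p) f.[x%:R] = - G.[p%:R].
  elim: p => [|p IHp]; first by rewrite big_ord0 G0 oppr0.
  by rewrite big_ord_recr /= IHp -dG hornerD hornerN horner_comp hornerD hornerX hornerC natr1 addKr.
rewrite fE in dG; rewrite {1}(antidifference G0 dG) hornerN opprK horner_sum.
by apply: eq_bigr => k _; rewrite hornerZ fall_natr; ring.
Qed.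
End Differences.

(** * Factorials modulo a prime and residues with vanishing power sums *)

Section LargePrime.

Lemma dvdn_mul_fact a b k : (0 < a)%N -> (a < b)%N -> (b <= k)%N -> (a * b %| k`!)%N.
Proof.
move=> a_gt0 lt_ab le_bk; apply: (@dvdn_trans b`!).
  by case: b lt_ab {le_bk} => // b lt_ab; rewrite factS mulnC dvdn_mul // dvdn_fact // a_gt0.
by rewrite -(bin_fact le_bk) mulnCA dvdn_mulr.
Qed.

(** If [p] and [t] differ, both occur as factors of the factorial. If [t = p], the factors [p] and
    [2 * p] serve, which is where [2 < p] enters. *)
Lemma prime_mul_dvd_fact p t : prime p -> (2 < p)%N -> (1 < t)%N -> (p * t %| (p * t).-1`!)%N.
Proof.
move=> p_pr p_gt2 t_gt1; case: (ltngtP p t) => [lt_pt|lt_tp|<-].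
- by apply: dvdn_mul_fact; nia.
- by rewrite mulnC; apply: dvdn_mul_fact => //; nia.
- apply: (@dvdn_trans (p * (2 * p))); first by rewrite dvdn_mul // dvdn_mull.
  by apply: dvdn_mul_fact; nia.
Qed.

Variables (L : fieldType) (V : place L) (p : nat).
Hypotheses (charL : [pchar L] =i pred0) (p_pr : prime p) (pM : p%:R \in vmax V).
Local Notation A := (vring V).
Local Notation M := (vmax V).

Lemma natrV_lt_vring k : (0 < k)%N -> (k < p)%N -> (k%:R)^-1 \in A.
Proof. by move=> k_gt0 lt_kp; apply: (natrV_vring p_pr) => //; rewrite gtnNdvd. Qed.

Lemma fact_vmax k : (k < p)%N -> (k`!)%:R \notin M.
Proof.
rewrite (natr_vmax p_pr) //; elim: k => [|k IHk] lt_kp; first by rewrite fact0 dvdn1 gtn_eqF ?prime_gt1.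
by rewrite factS Euclid_dvdM // negb_or gtnNdvd // IHk // ltnW.
Qed.

(** If [p] does not divide [k.+1], the denominator is a unit; if [k.+1] is a multiple of [p] other
    than [p], it divides the factorial. *)
Lemma prime_fact_ratio k : (2 < p)%N -> (k != p.-1)%N -> p%:R * ((k`!)%:R / k.+1%:R) \in M.
Proof.
move=> p_gt2 ne_k; have [/dvdnP[t Et]|ndvd] := boolP (p %| k.+1)%N; last first.
  by rewrite vmaxMr // rpredM ?rpred_nat // (natrV_vring p_pr).
have t_gt1 : (1 < t)%N by case: t Et => [|[|t]] // Et; case/eqP: ne_k; lia.
have [u Eu] := dvdnP (prime_mul_dvd_fact p_pr p_gt2 t_gt1).
have -> : k = (p * t).-1 by rewrite mulnC -Et.
have pt0 : (p * t)%:R != 0 :> L by rewrite natr_eq0_char0 // mulnC -Et.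
rewrite Eu prednK; last by rewrite mulnC -Et.
by rewrite [(u * _)%:R]natrM mulfK // vmaxMr // rpred_nat.
Qed.

Lemma horner_vmax (R : {poly L}) x y : R \is a polyOver A -> x \in A -> y \in A ->
  x - y \in M -> R.[x] - R.[y] \in M.
Proof.
move=> /polyOverP RA xA yA xyM; rewrite !horner_coef -sumrB rpred_sum // => k _.
rewrite -mulrBr subrXX vmaxM // vmaxMr // rpred_sum // => i _.
by rewrite rpredM ?rpredX.
Qed.

Lemma prod_not_vmax (I : finType) (P : pred I) (F : I -> L) :
  (forall i, P i -> F i \in A /\ F i \notin M) ->
  \prod_(i | P i) F i \in A /\ \prod_(i | P i) F i \notin M.
Proof.
move=> HF; apply: (big_ind (fun x => x \in A /\ x \notin M)) => //.
  by rewrite rpred1 vmax1.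
move=> x y [xA xM] [yA yM]; split; first exact: rpredM.
by apply: contra yM; exact: vmax_mull.
Qed.

(* If the residues of the b i are not all equal, a nonzero one has multiplicity c with 0 < c < p, and testing the
   power sums against a polynomial killing the other residues shows that p divides c. *)
Lemma equal_residues (b : 'I_p -> L) : (forall i, b i \in A) ->
  (forall m, (1 <= m)%N -> \sum_i b i ^+ m \in M) -> forall i j, b i - b j \in M.
Proof.
move=> bA sumM i0 j0; apply: contraT.
wlog bM : i0 j0 / b i0 \notin M => [H ijM|ijM].
  have [iM|iM] := boolP (b i0 \in M); last exact: H iM ijM.
  apply: (H j0 i0); last by rewrite -opprB rpredN.
  by apply: contra ijM => jM; rewrite rpredB.
pose c := b i0; pose far i := b i - c \notin M.
pose Q : {poly L} := \prod_(i | far i) ('X - (b i)%:P).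
have QA : Q \is a polyOver A.
  by apply: rpred_prod => i _; rewrite rpredB ?polyOverX // polyOverC.
have QE x : Q.[x] = \prod_(i | far i) (x - b i).
  by rewrite horner_prod; apply: eq_bigr => i _; rewrite hornerXsubC.
have [QcA QcM] : Q.[c] \in A /\ Q.[c] \notin M.
  rewrite QE; apply: prod_not_vmax => i far_i.
  by split; [exact: rpredB (bA i0) (bA i) | rewrite -opprB rpredN].
(* The extra factor [b i] makes all exponents positive, so that [sumM] applies; in exchange the
   residue of [c] must be nonzero. *)
have S1 : \sum_i b i * Q.[b i] \in M.
  have -> : \sum_i b i * Q.[b i] = \sum_(k < size Q) Q`_k * \sum_i b i ^+ k.+1.
    under eq_bigr => i _ do rewrite horner_coef mulr_sumr.
    rewrite exchange_big; apply: eq_bigr => k _; rewrite mulr_sumr.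
    by apply: eq_bigr => i _; rewrite mulrCA exprS.
  by rewrite rpred_sum // => k _; rewrite vmaxM ?(polyOverP QA) ?sumM.
have S2 : \sum_(i | ~~ far i) c * Q.[c] \in M.
  rewrite -[X in X \in _](subrKC (\sum_i b i * Q.[b i])) rpredD // -opprB rpredN.
  rewrite [X in X - _](bigID far) /= big1 ?add0r => [|i far_i]; last first.
    by rewrite QE (bigD1 i) //= subrr mul0r mulr0.
  rewrite -sumrB rpred_sum // => i; rewrite negbK => near_i.
  have -> : b i * Q.[b i] - c * Q.[c] = (b i - c) * Q.[b i] + c * (Q.[b i] - Q.[c]) by ring.
  apply: rpredD; first by apply: vmaxMr => //; exact: rpred_horner.
  by apply: vmaxM; [exact: bA | exact: (horner_vmax QA (bA i) (bA i0))].
move: S2; rewrite sumr_const -mulr_natl => cardM.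
(* Since [i0] is near and [j0] is far, the number of near indices lies strictly between 0 and
   [p]. *)
suff : (#|[pred i | ~~ far i]|)%:R \in M.
  rewrite (natr_vmax p_pr) // => /dvdn_leq; have i0near : i0 \in [pred i | ~~ far i].
    by rewrite !inE /far negbK subrr rpred0.
  have : (0 < #|[pred i | ~~ far i]|)%N by apply/card_gt0P; exists i0.
  move=> gt0 /(_ gt0); rewrite leqNgt => /negP[].
  rewrite -[X in (_ < X)%N](card_ord p); apply: proper_card; apply/properP.
  split; first exact/fintype.subsetP.
  by exists j0 => //; rewrite !inE /far negbK -opprB rpredN.
have := cardM; rewrite mulrC; apply: vmax_mull; first exact: rpredM (bA i0) QcA.
by apply: contra QcM; exact: (vmax_mull (bA i0) bM).
Qed.
End LargePrime.

(** * Polynomials all of whose powers have an indefinite sum with a double zero *)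

Section DifferenceVanishing.
Variable L : fieldType.
Hypothesis charL : [pchar L] =i pred0.

(* Write d_k for the coefficients of f^m in the falling factorial basis. The solution G has G(0) = G'(0) = 0, so
   the sum of (-1)^k k!/(k+1) d_k vanishes; multiplied by p this shows d_(p-1) = 0 modulo the maximal ideal, hence
   so is the sum of f^m over 0, ..., p - 1. For all m this forces f to be a constant residue, and m = 1 makes it 0. *)
Theorem difference_vanishing (f : {poly L}) :
  (forall m, (1 <= m)%N -> exists G : {poly L},
     [/\ G.[0] = 0, G^`().[0] = 0 & G - (G \Po ('X + 1)) = f ^+ m]) -> f = 0.
Proof.
wlog: f / f != 0 => [H Hf|f0 Hf].
  by have [//|f0] := eqVneq f 0; exact: H.
have [p lt_p p_pr] := prime_above (size f).+1.
have [V pM] := place_exists charL (prime_gt1 p_pr).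
have [c c0 [gA [i0 gi0]]] := normalize_coefs V f0.
set g := c *: f in gA gi0.
have size_g : size g = size f by rewrite size_scale.
have p_gt2 : (2 < p)%N by have : (0 < size f)%N; [rewrite size_poly_gt0 | lia].
have Hg m : (1 <= m)%N -> exists G : {poly L},
     [/\ G.[0] = 0, G^`().[0] = 0 & G - (G \Po ('X + 1)) = g ^+ m].
  move=> /Hf[G [G0 G'0 dG]]; exists (c ^+ m *: G).
  by rewrite derivZ !hornerZ G0 G'0 comp_polyZ -scalerBr dG exprZn mulr0.
have natA n : n%:R \in vring V by rewrite rpred_nat.
have signA n : (-1) ^+ n \in vring V by rewrite rpredX // rpredN rpred1.
have sumM m : (1 <= m)%N -> \sum_(x < p) g.[x%:R] ^+ m \in vmax V.
  move=> m_gt0; have [G [G0 G'0 dG]] := Hg m m_gt0.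
  have gmA : g ^+ m \is a polyOver (vring V) by rewrite rpredX.
  (* At least [p] terms are taken so that the index [p.-1] exists even for small degree. *)
  pose n := maxn (size (g ^+ m)) p.
  have [d dA dE] := fall_span gmA (leq_maxl _ p : (size (g ^+ m) <= n)%N).
  have lt_pn : (p.-1 < n)%N by rewrite (leq_trans _ (leq_maxr _ _)) // prednK // prime_gt0.
  have p0 : p%:R != 0 :> L by rewrite natr_eq0_char0 //; lia.
  have Ep : p.-1.+1 = p by rewrite prednK // prime_gt0.
  have dpM : d p.-1 \in vmax V.
    have Z : p%:R * \sum_(k < n) d k * ((-1) ^+ k * ((k`!)%:R / k.+1%:R)) = 0.
      by rewrite (double_zero_relation charL G0 G'0 (etrans dG dE)) mulr0.
    have : d p.-1 * ((-1) ^+ p.-1 * ((p.-1)`!)%:R) \in vmax V.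
      move/eqP: Z; rewrite mulr_sumr (bigD1 (Ordinal lt_pn)) //= Ep.
      have -> : p%:R * (d p.-1 * ((-1) ^+ p.-1 * (((p.-1)`!)%:R / p%:R))) =
                d p.-1 * ((-1) ^+ p.-1 * ((p.-1)`!)%:R) by field.
      rewrite addr_eq0 => /eqP ->; rewrite rpredN rpred_sum // => k.
      rewrite -val_eqE /= => ne_k; rewrite mulrCA vmaxM // mulrCA vmaxM //.
      exact: prime_fact_ratio.
    rewrite mulrC => H.
    suff : (-1) ^+ p.-1 * (d p.-1) \in vmax V.
      move/(vmaxM (signA p.-1)); rewrite mulrA -exprMn mulrNN mulr1 expr1n mul1r //.
    apply: (vmax_mull (natA (p.-1)`!)); first by rewrite (fact_vmax p_pr pM) // ltn_predL prime_gt0.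
    by rewrite mulrCA mulrA.
  under eq_bigr => x _ do rewrite -horner_exp.
  rewrite (sum_values charL p G0 dG dE) rpred_sum // => k _.
  (* Below [p] the falling factorial contributes a factor [p], beyond [p] it vanishes, and at [p]
     the coefficient is [d p.-1]. *)
  have [lt_kp|lt_pk|E] := ltngtP k.+1 p.
  - apply: vmaxM => //; apply: vmaxMr; last exact: (natrV_lt_vring p_pr pM).
    by rewrite ffactnS natrM; apply: vmaxMr.
  - by rewrite ffact_small // mul0r mulr0 rpred0.
  - by have -> : k = p.-1 :> nat; [lia | rewrite vmaxMr // Ep ffactnn -{1}Ep factS natrM Ep mulrC mulKf].
have eqM := @equal_residues L V p p_pr pM (fun x => g.[x%:R])
  (fun x => rpred_horner gA (natA x)) sumM.
have [e eA eE] := fall_span gA (leqnn _).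
have gval k : g.[k%:R] = \sum_(j < size g) e j * (k ^_ j)%:R.
  by rewrite {1}eE horner_sum; apply: eq_bigr => j _; rewrite hornerZ fall_natr.
have size_g0 : (0 < size g)%N by rewrite size_g size_poly_gt0.
(* As [g] has equal residues at [k] and 0, the lower coefficients being in the ideal forces [e k]
   times the unit [k!] into it. *)
have eM k : (0 < k)%N -> (k < size g)%N -> e k \in vmax V.
  elim/ltn_ind: k => k IHk k_gt0 lt_k.
  have lt_kp : (k < p)%N by lia.
  have := eqM (Ordinal lt_kp) (Ordinal (prime_gt0 p_pr)).
  rewrite /= !gval -sumrB (bigD1 (Ordinal lt_k)) //= ffactnn ffact0n gtn_eqF // mulr0 subr0.
  move=> H; suff : e k * (k`!)%:R \in vmax V by rewrite mulrC; apply: vmax_mull => //; exact: (fact_vmax p_pr pM).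
  rewrite -[_ * _](addrK (\sum_(j < size g | j != Ordinal lt_k) (e j * (k ^_ j)%:R - e j * (0 ^_ j)%:R))).
  apply: rpredB H _; apply: rpred_sum => j; rewrite -val_eqE /= => ne_jk.
  have [j0|j_gt0] := posnP j; first by rewrite j0 !ffactn0 subrr rpred0.
  rewrite [(0 ^_ j)%N]ffact0n (gtn_eqF j_gt0) mulr0 subr0.
  have [lt_kj|le_jk] := ltnP k j; first by rewrite ffact_small // mulr0 rpred0.
  by rewrite vmaxMr // IHk // ltn_neqAle ne_jk.
have e0M : e 0%N \in vmax V.
  have [G [G0 G'0 dG]] := Hg 1%N isT; rewrite expr1 in dG.
  have := double_zero_relation charL G0 G'0 (etrans dG eE).
  rewrite (bigD1 (Ordinal size_g0)) //= expr0 fact0 divr1 !mulr1 => /eqP.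
  rewrite addr_eq0 => /eqP ->; rewrite rpredN rpred_sum // => k; rewrite -val_eqE /= -lt0n => k_gt0.
  rewrite vmaxMr ?eM // rpredM // rpredM // (natrV_lt_vring p_pr pM) //.
  by apply: leq_ltn_trans (ltn_ord k) _; rewrite size_g ltnW.
case/negP: gi0; rewrite eE coef_sum rpred_sum // => k _.
rewrite coefZ vmaxMr //; last exact: (polyOverP (fall_polyOver _ _)).
by have [->|k_gt0] := posnP k => //; exact: eM.
Qed.
End DifferenceVanishing.

(** * Newton's identities and divisibility of powers *)

Section PowerSums.

(* Newton's identities, as the expansion at infinity of the logarithmic derivative of prod (X - b_i). *)
Lemma newton_expansion (R : comNzRingType) (b : nat -> R) (N M : nat) :
  let G := \prod_(i < N) ('X - (b i)%:P) in
  exists2 E : {poly R}, (size E <= N)%N &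
  'X^M * G^`() = G * (\sum_(k < M) 'X^(M.-1 - k) * (\sum_(i < N) b i ^+ k)%:P) + E.
Proof.
move=> G; rewrite {}/G; elim: N => [|N [E le_E IHN]].
  exists 0; first by rewrite size_poly0.
  rewrite big_ord0 derivC mulr0 addr0 big1 ?mulr0 // => k _.
  by rewrite big_ord0 mulr0.
set G := \prod_(i < N) _ in IHN *.
(* The new geometric sum times ['X - b N] is ['X^M] minus the [M]-th power of [b N], so the new
   factor adds that power times [G] to the remainder. *)
exists (E * ('X - (b N)%:P) + (b N ^+ M)%:P * G).
  rewrite (leq_trans (size_polyD _ _)) // geq_max; apply/andP; split.
    have [->|E0] := eqVneq E 0; first by rewrite mul0r size_poly0.
    by rewrite size_Mmonic ?monicXsubC // size_XsubC addn2.
  by rewrite mul_polyC (leq_trans (size_scale_leq _ _)) // size_prod_XsubC /index_enum -enumT size_enum_ord.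
rewrite big_ord_recr /= -/G derivM derivB derivX derivC subr0 mulr1.
have EX := subrXX ('X : {poly R}) (b N)%:P M.
have -> : \sum_(k < M) 'X^(M.-1 - k) * (\sum_(i < N.+1) b i ^+ k)%:P =
  \sum_(k < M) 'X^(M.-1 - k) * (\sum_(i < N) b i ^+ k)%:P +
  \sum_(k < M) 'X^(M.-1 - k) * (b N)%:P ^+ k.
  rewrite -big_split; apply: eq_bigr => k _ /=.
  by rewrite big_ord_recr /= polyCD mulrDr -polyC_exp.
rewrite mulrDr mulrA IHN; move/eqP: EX; rewrite subr_eq -polyC_exp => /eqP ->; ring.
Qed.

Lemma dvdp_sum (K : fieldType) (I : Type) (r : seq I) (Q : pred I) (P : {poly K}) (F : I -> {poly K}) :
  (forall i, Q i -> P %| F i) -> P %| \sum_(i <- r | Q i) F i.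
Proof.
by move=> H; apply: (big_ind (fun x => P %| x)) => // x y; exact: dvdp_add.
Qed.

(** Newton's identities express [N - l] times the coefficient of index [l] of [G] through power
    sums, so [P] divides every coefficient below the leading one. Evaluating [G] at its root [b i]
    gives the claim. *)
Lemma dvdp_power_sums (K : fieldType) (P : {poly K}) (N : nat) (b : nat -> {poly K}) :
  [pchar K] =i pred0 ->
  (forall m, (1 <= m)%N -> P %| \sum_(i < N) b i ^+ m) ->
  forall i, (i < N)%N -> P %| b i ^+ N.
Proof.
move=> charK dvdP i0 lt_i0.
pose G := \prod_(i < N) ('X - (b i)%:P).
have size_G : size G = N.+1 by rewrite size_prod_XsubC /index_enum -enumT size_enum_ord.
have G_monic : G \is monic by apply: monic_prod => i _; exact: monicXsubC.
have [E le_E EG] := newton_expansion b N N.+1.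
have dvdG l : (l < N)%N -> P %| G`_l.
  (* In degree [N + l] the remainder [E], of size at most [N], has no coefficient. *)
  move=> lt_l; have := congr1 (fun q : {poly {poly K}} => q`_(N + l)) EG.
  rewrite /= -/G coefD [E`__]nth_default ?addr0; last by rewrite (leq_trans le_E) ?leq_addr.
  have -> : ('X^(N.+1) * G^`())`_(N + l) = G`_l *+ l.
    rewrite coefXnM; case: l lt_l => [|l] lt_l; first by rewrite addn0 ltnSn mulr0n.
    by rewrite coef_deriv ifF; [congr (_`_ _ *+ _); lia | lia].
  rewrite mulr_sumr coef_sum big_ord_recl /= subn0 => El.
  have {}El : G`_l * (l%:R - N%:R) = \sum_(i < N)
       (G * ('X^(N - bump 0 i) * (\sum_(i1 < N) b i1 ^+ bump 0 i)%:P))`_(N + l).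
    rewrite mulrBr mulr_natr El addrC mulrA coefMC coefMXn ltnNge leq_addr /= addKn.
    rewrite (eq_bigr (fun=> 1)) => [|i _]; last by rewrite expr0.
    by rewrite sumr_const card_ord addKr.
  have : P %| G`_l * (l%:R - N%:R).
    rewrite El; apply: dvdp_sum => i _; rewrite mulrA coefMC dvdp_mull //; exact: dvdP.
  have -> : l%:R - N%:R = (- (N - l)%:R)%:P :> {poly K}.
    by rewrite polyCN polyC_natr natrB ?opprB // ltnW.
  rewrite mulrC mul_polyC dvdpZr // oppr_eq0 natr_eq0_char0 //; lia.
have : G.[b i0] = 0.
  by rewrite horner_prod (bigD1 (Ordinal lt_i0)) //= hornerXsubC subrr mul0r.
rewrite horner_coef size_G big_ord_recr /=.
have -> : G`_N = 1 by have := G_monic; rewrite monicE lead_coefE size_G => /eqP.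
rewrite mul1r => /eqP; rewrite addr_eq0 eq_sym eqr_oppLR => /eqP ->.
rewrite dvdpNr; apply: dvdp_sum => l _; rewrite dvdp_mulr //; exact: dvdG.
Qed.
End PowerSums.

Lemma ltn_sqr_exp n : (n * n < 2 ^ (2 * n))%N.
Proof. by rewrite mul2n -addnn expnD ltn_mul // ltn_expl. Qed.

(** * Endomorphisms of degree at least two *)

Section Endomorphism.
Variables (K : fieldType) (phi : {lrmorphism {poly K} -> {poly K}}).
Hypothesis charK : [pchar K] =i pred0.

Lemma lrmorph_comp p : phi p = p \Po phi 'X.
Proof.
elim/poly_ind: p => [|p c IHp]; first by rewrite comp_poly0 rmorph0.
rewrite rmorphD rmorphM /= IHp comp_polyD comp_polyM comp_polyX comp_polyC; congr (_ + _).
by rewrite -alg_polyC linearZ rmorph1.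
Qed.

Lemma iter_lrmorph_comp n p : iter n phi p = p \Po iter n phi 'X.
Proof.
elim: n => [|n IHn] /=; first by rewrite comp_polyXr.
by rewrite IHn lrmorph_comp -comp_polyA -[_ \Po phi 'X]lrmorph_comp.
Qed.

Lemma size_iter_lrmorph n : (size (iter n phi 'X)).-1 = ((size (phi 'X)).-1 ^ n)%N.
Proof.
elim: n => [|n IHn] /=; first by rewrite size_polyX.
by rewrite lrmorph_comp size_comp_poly IHn expnSr.
Qed.

Lemma dvdp_comp_sub (g q r : {poly K}) : q - r %| (g \Po q) - (g \Po r).
Proof.
rewrite !comp_polyE -sumrB; apply: dvdp_sum => i _.
by rewrite -scalerBr -mul_polyC subrXX dvdp_mull // dvdp_mulr.
Qed.

(* If a^m = g_m - phi g_m then the power sums of the phi^i a, i < N, telescope to g_m - phi^N g_m, which is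
   divisible by phi^N X - X. Newton's identities then make phi^N X - X, of degree e^N, divide a^N. *)
Theorem image_powers_vanish (a : {poly K}) : (3 <= size (phi 'X))%N ->
  (forall m, (1 <= m)%N -> exists g, a ^+ m = g - phi g) -> a = 0.
Proof.
move=> size_phi Ha; apply/eqP; apply: contraT => a0.
(* With [s = size a], taking [N = 4s] gives [2 ^ N > (2s) ^ 2], which exceeds [N] times the degree
   of [a]. *)
pose n := (2 * size a)%N; pose N := (2 * n)%N.
pose P := iter N phi 'X - 'X.
have N_gt0 : (0 < N)%N by have : (0 < size a)%N; [rewrite size_poly_gt0 | rewrite /N /n; lia].
have iterX i m : iter i phi (a ^+ m) = iter i phi a ^+ m.
  by elim: i => //= i ->; rewrite rmorphXn.
have : P %| iter 0 phi a ^+ N.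
  apply: (dvdp_power_sums (b := fun i => iter i phi a)) => // m /Ha[g ag].
  have -> : \sum_(i < N) iter i phi a ^+ m = g - iter N phi g.
    elim: (N) => [|k IHk]; first by rewrite big_ord0 subrr.
    rewrite big_ord_recr /= IHk -iterX ag.
    have -> : iter k phi (g - phi g) = iter k phi g - iter k.+1 phi g.
      by elim: k {IHk} => //= k ->; rewrite rmorphB.
    by rewrite addrA subrK.
  rewrite -dvdpNr opprB iter_lrmorph_comp -[X in _ - X]comp_polyXr; exact: dvdp_comp_sub.
move=> /dvdp_leq; rewrite expf_eq0 (negPf a0) andbF => /(_ isT).
have lt_nN : (n * n < 2 ^ N)%N := ltn_sqr_exp n.
have le_e : (2 ^ N <= (size (phi 'X)).-1 ^ N)%N by rewrite leq_exp2r //; lia.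
have size_y := size_iter_lrmorph N.
have -> : size P = size (iter N phi 'X).
  rewrite /P size_polyDl // size_polyN size_polyX.
  by move: (2 ^ N)%N lt_nN le_e size_y => *; lia.
move/leq_trans/(_ (size_poly_exp_leq a N)).
have s_gt0 : (0 < size a)%N by rewrite size_poly_gt0.
have : ((size a).-1 * N <= n * n)%N.
  by move: s_gt0; rewrite /N /n; move: (size a) => s; case: s => // s _; nia.
rewrite -size_y in le_e; clear size_y; move: (2 ^ N)%N (n * n)%N lt_nN le_e => t u lt_ut le_t le_u le_y.
have : (t <= u)%N.
  by apply: leq_trans le_u; rewrite (leq_trans le_t) // -subn1 leq_subLR add1n.
by rewrite leqNgt lt_ut.
Qed.
End Endomorphism.

(** * Roots in extension fields *)

Section Roots.
Variable K : fieldType.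

Lemma irreducible_factor (q : {poly K}) : (1 < size q)%N ->
  exists2 p, irreducible_poly p & p %| q.
Proof.
move=> q_gt1; pose P n := `[< exists p : {poly K}, [/\ (1 < size p)%N, p %| q & size p = n] >].
have exP : exists n, P n by exists (size q); apply/asboolP; exists q.
case: (ex_minnP exP) => n /asboolP[p [p_gt1 pq size_p]] minn.
exists p => //; split=> // d d1 dp.
have p0 : p != 0 by rewrite -size_poly_gt0 ltnW.
have d0 : d != 0 by apply: contraNneq p0 => d0; rewrite -dvd0p -d0.
rewrite -(dvdp_size_eqp dp) eqn_leq dvdp_leq //= size_p minn //.
apply/asboolP; exists d; split=> //; last exact: dvdp_trans pq.
by rewrite ltn_neqAle eq_sym d1 size_poly_gt0.
Qed.

Lemma root_in_extension (q : {poly K}) : (1 < size q)%N ->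
  exists (E : fieldType) (f : {rmorphism K -> E}) (z : E), root (map_poly f q) z.
Proof.
move=> /irreducible_factor[p p_irr pq].
have [E _ [z pz _]] := irredp_FAdjoin p_irr.
exists E, (GRing.in_alg E), z; by move: pz; rewrite -!dvdp_XsubCl => /dvdp_trans; apply; rewrite dvdp_map.
Qed.

Lemma coef_XsubC_exp (r : K) k : (('X - r%:P) ^+ k.+1)`_k = - r *+ k.+1.
Proof.
elim: k => [|k IHk]; first by rewrite expr1 coefB coefX coefC sub0r.
have lead1 : (('X - r%:P) ^+ k.+1)`_k.+1 = 1.
  have := monic_exp k.+1 (monicXsubC r).
  by rewrite monicE lead_coefE size_exp_XsubC => /eqP.
by rewrite exprS mulrBl coefB coefXM coefCM IHk lead1 mulr1 -mulrSr.
Qed.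
End Roots.

(** All powers of ['X - r] are divided out for one root [r] in an extension; a nonconstant cofactor
    yields a second root. Otherwise the two top coefficients of [u] determine [r], by division by
    the multiplicity, so [r] comes from [K]. *)
Lemma pure_power_or_two_roots (K : fieldType) (u : {poly K}) : [pchar K] =i pred0 -> u != 0 ->
  (exists (c r : K) (k : nat), c != 0 /\ u = c *: ('X - r%:P) ^+ k) \/
  (exists (E : fieldType) (f : {rmorphism K -> E}) (r s : E),
     [/\ r != s, root (map_poly f u) r & root (map_poly f u) s]).
Proof.
move=> charK u0; case: (leqP (size u) 1) => [/size1_polyC E|u_gt1].
  left; exists u`_0, 0, 0%N; rewrite expr0 alg_polyC -E; split=> //.
  by apply: contraNneq u0 => u00; rewrite E u00.
have [E [f [r ur]]] := root_in_extension u_gt1.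
have [k [q q_r uE]] := multiplicity_XsubC (map_poly f u) r.
have fu0 : map_poly f u != 0 by rewrite map_poly_eq0.
rewrite fu0 /= in q_r.
have k_gt0 : (0 < k)%N.
  by case: k uE => // uE; move: ur; rewrite uE expr0 mulr1 (negPf q_r).
case: (leqP (size q) 1) => [/size1_polyC qE|q_gt1]; last first.
  right; have [E' [f' [s qs]]] := root_in_extension q_gt1.
  have mapE : map_poly (f' \o f) u = map_poly f' (map_poly f u) by rewrite map_poly_comp.
  exists E', (f' \o f), (f' r), s; split.
  - by apply: contraTneq qs => <-; rewrite fmorph_root.
  - by rewrite mapE fmorph_root.
  - by rewrite mapE uE rmorphM rootM qs.
left; set c := q`_0 in qE; have c0 : c != 0.
  by apply: contraNneq q_r => c0; rewrite qE c0 root0.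
case: k k_gt0 uE => // k _ uE; rewrite qE mul_polyC in uE.
have uk1 : f u`_k.+1 = c.
  have := congr1 (fun p : {poly E} => p`_k.+1) uE; rewrite coef_map coefZ /= => ->.
  have := monic_exp k.+1 (monicXsubC r).
  by rewrite monicE lead_coefE size_exp_XsubC => /eqP /= ->; rewrite mulr1.
have uk : f u`_k = c * (- r *+ k.+1).
  by have := congr1 (fun p : {poly E} => p`_k) uE; rewrite coef_map coefZ /= coef_XsubC_exp.
have k0 : k.+1%:R != 0 :> E by rewrite -(rmorph_nat f) fmorph_eq0 natr_eq0_char0.
pose r0 := - (u`_k / (u`_k.+1 * k.+1%:R)).
have fr0 : f r0 = r.
  rewrite rmorphN fmorph_div rmorphM rmorph_nat /= uk uk1 -(mulr_natr (- r)).
  by rewrite invfM mulrACA mulfV // mul1r mulfK // opprK.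
exists u`_k.+1, r0, k.+1; split; first by rewrite -(fmorph_eq0 f) uk1.
apply: (@map_poly_inj _ _ f).
by rewrite uE map_polyZ rmorphXn rmorphB /= map_polyX map_polyC /= uk1 fr0.
Qed.

(** * Ideals, derivations and shifts of the polynomial ring *)

Section Ideals.
Variable K : fieldType.

Lemma ideal_principal (I : {poly K} -> Prop) : is_ideal I ->
  exists u, forall p, I p <-> u %| p.
Proof.
move=> [I0 ID IM]; case: (pselect (exists2 p, I p & p != 0)) => [[p Ip p0]|no_p]; last first.
  exists 0 => p; rewrite dvd0p; split=> [Ip|/eqP->//].
  by apply: contrapT => p0; apply: no_p; exists p => //; apply/negP.
pose P n := `[< exists p : {poly K}, [/\ I p, p != 0 & size p = n] >].
have exP : exists n, P n by exists (size p); apply/asboolP; exists p.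
case: (ex_minnP exP) => n /asboolP[u [Iu u0 size_u]] minn.
exists u => q; split=> [Iq|/dvdpP[r ->]]; last exact: IM.
rewrite -[_ %| _]negbK; apply/negP => ndvd.
have Ir : I (q %% u).
  have -> : q %% u = q + - (q %/ u) * u by rewrite {2}(divp_eq q u) mulNr addrC addKr.
  by apply: ID => //; exact: IM.
have : (n <= size (q %% u)%R)%N by apply: minn; apply/asboolP; exists (q %% u).
by rewrite leqNgt -size_u ltn_modp u0.
Qed.

Lemma mathieu_of_trivial (V : {poly K} -> Prop) : V 0 ->
  (forall a, (forall m, (1 <= m)%N -> V (a ^+ m)) -> a = 0) -> mathieu_subspace V.
Proof.
move=> V0 HV a b /HV ->; exists 1%N => m m_gt0.
by rewrite expr0n gtn_eqF // mul0r.
Qed.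

Lemma derivation_deriv (D : {poly K} -> {poly K}) : K_derivation D ->
  forall p, D p = p^`() * D 'X.
Proof.
move=> [D_lin D_leibniz].
have D1 : D 1 = 0.
  by have := D_leibniz 1 1; rewrite !mul1r mulr1 => /eqP; rewrite -subr_eq0 opprD addNKr oppr_eq0 => /eqP.
have D0 : D 0 = 0 by have := D_leibniz 0 0; rewrite !mul0r mulr0 addr0.
elim/poly_ind => [|p c IHp]; first by rewrite D0 deriv0 mul0r.
rewrite -alg_polyC addrC D_lin D1 scaler0 add0r D_leibniz IHp.
by rewrite derivD derivM derivX derivZ -(polyC1 K) derivC; ring.
Qed.

(** If [D 'X] were nonconstant, [D] would send nonconstant polynomials to nonconstant ones, and no
    iterate would kill ['X]. *)
Lemma lnd_constant (D : {poly K} -> {poly K}) : [pchar K] =i pred0 ->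
  K_derivation D -> locally_nilpotent D -> exists c, D 'X = c%:P.
Proof.
move=> charK DD D_nil; have DE := derivation_deriv DD.
case: (leqP (size (D 'X)) 1) => [/size1_polyC E|t_gt1]; first by exists (D 'X)`_0.
have [m _ Dm] := D_nil 'X.
have : (1 < size (iter m D 'X))%N.
  elim: m {Dm} => [|m IHm]; first by rewrite size_polyX.
  rewrite /= DE; set p := iter m D 'X in IHm *.
  case Ep: (size p) IHm => [|[|n]] // _.
  have p'n : p^`()`_n != 0.
    rewrite coef_deriv -mulr_natr mulf_eq0 natr_eq0_char0 // orbF.
    by rewrite -[n.+1]/(n.+2.-1) -Ep -lead_coefE lead_coef_eq0 -size_poly_gt0 Ep.
  have p'0 : p^`() != 0 by apply: contraNneq p'n => ->; rewrite coef0.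
  have t0 : D 'X != 0 by rewrite -size_poly_gt0 ltnW.
  have : (n < size p^`())%N by rewrite ltnNge; apply: contra p'n => le_n; rewrite nth_default.
  rewrite size_mul //; move: (size p^`()) (size (D 'X)) t_gt1 => x y; lia.
by rewrite Dm size_poly0.
Qed.

(** Termwise integration of the Taylor expansion at [r]: each induction step splits off [q.[r]] and
    passes to exponent [k.+1]. *)
Lemma deriv_image_power (r : K) (k n : nat) (q : {poly K}) : [pchar K] =i pred0 ->
  (size q <= n)%N ->
  exists h, (('X - r%:P) ^+ k.+1 * h)^`() = ('X - r%:P) ^+ k * q.
Proof.
move=> charK; elim: n k q => [|n IHn] k q le_n.
  by exists 0; rewrite mulr0 deriv0 (size_poly_leq0P _ le_n) mulr0.
have [|h hE] := IHn k.+1 (q %/ ('X - r%:P)).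
  by rewrite size_divp ?polyXsubC_eq0 // size_XsubC leq_subLR add1n.
exists (('X - r%:P) * h + (q.[r] / k.+1%:R)%:P).
rewrite mulrDr derivD mulrA -exprSr hE [_ * _%:P]mulrC mul_polyC derivZ deriv_exp.
rewrite derivB derivX derivC subr0 mul1r /= -scaler_nat scalerA divfK ?natr_eq0_char0 //.
by rewrite {3}(divp_eq q ('X - r%:P)) modp_XsubC mulrDr exprSr -mulrA -mul_polyC; ring.
Qed.

(** For step 1 a solution is explicit in falling factorials; scaling the variable by [c] reduces
    step [c] to it. *)
Lemma shift_image (c : K) (p : {poly K}) : [pchar K] =i pred0 -> c != 0 ->
  exists g, g - (g \Po ('X + c%:P)) = p.
Proof.
move=> charK c0; pose S : {pred K} := predT.
have ringS : subring_closed S by [].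
pose A : subringClosed K := HB.pack S (GRing.isSubringClosed.Build K S ringS).
have qA : p \Po (c *: 'X) \is a polyOver A by apply/polyOverP.
have [d _] := fall_span qA (leqnn _); move: (size _) => n dE.
pose G := - \sum_(k < n) (d k / k.+1%:R) *: fall K k.+1.
have dG : G - (G \Po ('X + 1)) = p \Po (c *: 'X).
  rewrite dE /G [_ \Po _]raddfN /= opprK addrC [_ \Po _]raddf_sum /= -sumrB.
  apply: eq_bigr => k _; rewrite comp_polyZ -scalerBr fall_diff scalerA divfK //.
  by rewrite natr_eq0_char0.
exists (G \Po (c^-1 *: 'X)).
have -> : (G \Po (c^-1 *: 'X)) \Po ('X + c%:P) = (G \Po ('X + 1)) \Po (c^-1 *: 'X).
  rewrite -!comp_polyA; congr (_ \Po _).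
  rewrite comp_polyZ comp_polyX comp_polyD comp_polyX scalerDr -[1]/(1%:P) comp_polyC.
  by congr (_ + _); rewrite -mul_polyC -polyCM mulVf.
rewrite -comp_polyB dG -comp_polyA comp_polyZ comp_polyX scalerA mulfV // scale1r.
by rewrite comp_polyXr.
Qed.
End Ideals.

(** * Affine substitutions over an extension field *)

Section Transfer.
Variables (K E : fieldType) (f : {rmorphism K -> E}).
Hypothesis charK : [pchar K] =i pred0.

Let charE : [pchar E] =i pred0.
Proof. by move=> p; rewrite (fmorph_pchar f). Qed.

Lemma comp_affine_eq0 (p : {poly K}) (l : {poly E}) : (1 < size l)%N ->
  map_poly f p \Po l = 0 -> p = 0.
Proof. by move=> l_gt1 /eqP; rewrite comp_poly_eq0 // map_poly_eq0 => /eqP. Qed.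

Lemma size_affine (c r : E) : c != 0 -> size (c *: 'X + r%:P) = 2%N.
Proof.
by move=> c0; rewrite size_polyDl size_scale ?size_polyX // ltnS size_polyC leq_b1.
Qed.

Lemma horner_affine (c r x : E) : (c *: 'X + r%:P).[x] = c * x + r.
Proof. by rewrite hornerD hornerZ hornerX hornerC. Qed.

Lemma deriv_affine (c r : E) : (c *: 'X + r%:P)^`() = c%:P.
Proof. by rewrite derivD derivZ derivX derivC addr0 alg_polyC. Qed.

(** The map [l] carries 0 and 1 to [r] and [s], where [g] vanishes; the factor [s - r] from the
    chain rule is divided out. *)
Lemma two_roots_vanishing (u a : {poly K}) (c : K) (r s : E) : c != 0 -> r != s ->
  root (map_poly f u) r -> root (map_poly f u) s ->
  (forall m, (1 <= m)%N -> exists2 g, u %| g & a ^+ m = c *: g^`()) -> a = 0.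
Proof.
move=> c0 rs ur us Ha; have sr0 : s - r != 0 by rewrite subr_eq0 eq_sym.
have fc0 : f c != 0 by rewrite fmorph_eq0.
pose l := (s - r) *: 'X + r%:P.
apply: (@comp_affine_eq0 a l); first by rewrite size_affine.
apply: (moment_vanishing charE) => m /Ha[g /dvdpP[q gE] am].
exists ((f c / (s - r)) *: (map_poly f g \Po l)).
  rewrite derivZ deriv_comp deriv_affine deriv_map [_ * (s - r)%:P]mulrC mul_polyC scalerA divfK //.
  by rewrite -comp_polyZ -map_polyZ -am !rmorphXn.
have g0 x : root (map_poly f u) x -> (map_poly f g).[x] = 0.
  by move=> /rootP ux; rewrite gE rmorphM hornerM ux mulr0.
rewrite !hornerZ !horner_comp !horner_affine mulr1 mulr0 add0r subrK.
by rewrite !g0.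
Qed.

(** The map [l] turns the shift by [c] into the unit shift and moves the double root to 0. *)
Lemma repeated_root_vanishing (u a : {poly K}) (c : K) (z : E) : c != 0 ->
  ('X - z%:P) ^+ 2 %| map_poly f u ->
  (forall m, (1 <= m)%N -> exists2 g, u %| g & a ^+ m = g - (g \Po ('X + c%:P))) -> a = 0.
Proof.
move=> c0 uz Ha; have fc0 : f c != 0 by rewrite fmorph_eq0.
pose l := f c *: 'X + z%:P.
apply: (@comp_affine_eq0 a l); first by rewrite size_affine.
apply: (difference_vanishing charE) => m /Ha[g ug am].
have /dvdpP[q gE] : ('X - z%:P) ^+ 2 %| map_poly f g.
  by apply: dvdp_trans uz _; rewrite dvdp_map.
exists (map_poly f g \Po l); split.
- by rewrite horner_comp horner_affine mulr0 add0r gE hornerM horner_exp hornerXsubC subrr expr0n mulr0.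
- rewrite deriv_comp hornerM horner_comp horner_affine mulr0 add0r gE derivM expr2 derivM.
  by rewrite derivB derivX derivC !(hornerD, hornerM, hornerN) hornerX hornerC subrr; ring.
- have -> : (map_poly f g \Po l) \Po ('X + 1) = map_poly f (g \Po ('X + c%:P)) \Po l.
    rewrite map_comp_poly rmorphD /= map_polyX map_polyC /= -!comp_polyA; congr (_ \Po _).
    rewrite !comp_polyD comp_polyZ !comp_polyX !comp_polyC scalerDr alg_polyC.
    by rewrite -!addrA [z%:P + _]addrC.
  by rewrite -comp_polyB -rmorphB /= -am !rmorphXn.
Qed.
End Transfer.

(** * The three cases *)

Section Cases.
Variable K : fieldType.
Hypothesis charK : [pchar K] =i pred0.

Lemma mathieu_derivation (I : {poly K} -> Prop) (D : {poly K} -> {poly K}) : is_ideal I ->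
  K_derivation D -> locally_nilpotent D -> mathieu_subspace (image_of D I).
Proof.
move=> HI DD D_nil; have [u uP] := ideal_principal HI; have [I0 _ _] := HI.
have [c cE] := lnd_constant charK DD D_nil.
have DE p : D p = c *: p^`() by rewrite (derivation_deriv DD) cE mulrC mul_polyC.
have V0 : image_of D I 0 by exists 0; rewrite // DE deriv0 scaler0.
have [c0|c0] := eqVneq c 0.
  apply: mathieu_of_trivial => // a /(_ 1%N isT)[g _].
  by rewrite expr1 DE c0 scale0r.
have [u0|u0] := eqVneq u 0.
  apply: mathieu_of_trivial => // a /(_ 1%N isT)[g /uP].
  by rewrite u0 dvd0p => /eqP ->; rewrite expr1 DE deriv0 scaler0.
case: (pure_power_or_two_roots charK u0) => [[e [r [k [e0 uE]]]]|[E [f [r [s [rs ur us]]]]]]; last first.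
  apply: mathieu_of_trivial => // a Ha; apply: (two_roots_vanishing charK c0 rs ur us).
  by move=> m /Ha[g /uP ug ->]; exists g.
(* Here the image is the ideal generated by the power of exponent [k.-1]; for [k = 0] this is the
   whole ring. *)
have dvdD b : image_of D I b -> ('X - r%:P) ^+ k.-1 %| b.
  move=> [g /uP]; rewrite uE dvdpZl // => /dvdpP[h ->] ->.
  rewrite DE dvdpZr // derivM deriv_exp dvdp_add //; last first.
    by rewrite dvdp_mull // -mulr_natr dvdp_mulr // dvdp_mull.
  by rewrite dvdp_mull // dvdp_exp2l // leq_pred.
move=> a b Ha; exists 1%N => m /Ha/dvdD/dvdpP[q ->].
have [h hE] := deriv_image_power r k.-1 charK (leqnn (size (c^-1 *: (q * b)))).
exists (('X - r%:P) ^+ k.-1.+1 * h).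
  by apply/uP; rewrite uE dvdpZl // dvdp_mulr // dvdp_exp2l // leqSpred.
by rewrite DE hE -scalerAr scalerA mulfV // scale1r -mulrA mulrCA.
Qed.

Lemma mathieu_expanding (I : {poly K} -> Prop) (phi : {lrmorphism {poly K} -> {poly K}})
    (delta : {poly K} -> {poly K}) : is_ideal I -> (forall p, delta p = p - phi p) ->
  (3 <= size (phi 'X))%N -> mathieu_subspace (image_of delta I).
Proof.
move=> [I0 _ _] deltaE size_phi; apply: mathieu_of_trivial.
  by exists 0; rewrite // deltaE rmorph0 subr0.
move=> a Ha; apply: (image_powers_vanish charK size_phi) => m /Ha[g _ ->].
by exists g; rewrite deltaE.
Qed.

Lemma dvdp_small_root (u : {poly K}) : u != 0 -> (size u <= 2)%N ->
  exists r, forall g, g.[r] = 0 -> u %| g.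
Proof.
move=> u0 u_le2; case: (leqP (size u) 1) => [u_le1|u_gt1].
  exists 0 => g _; have /eqP : size u = 1%N by apply/eqP; rewrite eqn_leq u_le1 size_poly_gt0.
  by rewrite size_poly_eq1 => /eqp_dvdl ->; exact: dvd1p.
have /eqP u2 : size u = 2%N by apply/eqP; rewrite eqn_leq u_le2.
have u1 : u`_1 != 0 by rewrite -[1%N]/(2.-1) -(eqP u2) -lead_coefE lead_coef_eq0.
exists (- u`_0 / u`_1) => g /rootP; rewrite -dvdp_XsubCl.
have uE : u = u`_1 *: ('X - (- u`_0 / u`_1)%:P).
  apply/polyP => i; rewrite coefZ coefB coefX coefC.
  case: i => [|[|i]] /=; [by rewrite sub0r mulNr opprK mulrC divfK | by rewrite subr0 mulr1 |].
  by rewrite nth_default ?(eqP u2) // subr0 mulr0.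
by move=> rg; rewrite uE dvdpZl.
Qed.

Lemma mathieu_shift (I : {poly K} -> Prop) (phi : {lrmorphism {poly K} -> {poly K}})
    (delta : {poly K} -> {poly K}) (c : K) (u : {poly K}) :
  (forall p, delta p = p - phi p) -> phi 'X = 'X + c%:P ->
  (forall p, I p <-> exists q, p = u * q) ->
  (u = 0 \/ (size u <= 2)%N \/ has_repeated_root u) ->
  mathieu_subspace (image_of delta I).
Proof.
move=> deltaE phiX IP cases.
have uP p : I p <-> u %| p.
  split=> [/IP[q ->]|/dvdpP[q ->]]; first exact: dvdp_mulr.
  by apply/IP; exists q; rewrite mulrC.
have {}deltaE p : delta p = p - (p \Po ('X + c%:P)) by rewrite deltaE lrmorph_comp phiX.
have V0 : image_of delta I 0.
  by exists 0; [apply/uP; exact: dvdp0 | rewrite deltaE comp_poly0 subr0].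
have [c0|c0] := eqVneq c 0.
  apply: mathieu_of_trivial => // a /(_ 1%N isT)[g _].
  by rewrite expr1 deltaE c0 addr0 comp_polyXr subrr.
have [u0|u0] := eqVneq u 0.
  apply: mathieu_of_trivial => // a /(_ 1%N isT)[g /uP].
  by rewrite u0 dvd0p => /eqP ->; rewrite expr1 deltaE comp_poly0 subr0.
case: cases => [/eqP|[u_le2|[E [f [z uz]]]]]; first by rewrite (negPf u0).
  (* The image is the whole ring: a preimage can be made to vanish at [r] by subtracting a constant,
     which [delta] kills. *)
  have [r dvdu] := dvdp_small_root u0 u_le2.
  move=> a b _; exists 0%N => m _; have [g gE] := shift_image (a ^+ m * b) charK c0.
  exists (g - g.[r]%:P); first by apply/uP/dvdu; rewrite hornerD hornerN hornerC subrr.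
  by rewrite deltaE comp_polyB comp_polyC -gE; ring.
apply: mathieu_of_trivial => // a Ha; apply: (repeated_root_vanishing charK c0 uz).
by move=> m /Ha[g /uP ug ->]; exists g; rewrite // deltaE.
Qed.
End Cases.

Unset Implicit Arguments.

Theorem theorem1p6 (K : fieldType) (charK0 : [pchar K] =i pred0)
    (I : {poly K} -> Prop) (HI : is_ideal I) (delta : {poly K} -> {poly K}) :
  (* 1) delta is a locally nilpotent K-derivation *)
  (K_derivation delta /\ locally_nilpotent delta)
  \/
  (* 2) delta = id - phi, phi a K-algebra endomorphism, deg phi(x) >= 2 *)
  (exists phi : {lrmorphism {poly K} -> {poly K}},
      (forall p, delta p = p - phi p) /\ (3 <= size (phi 'X))%N)
  \/
  (* 3) delta = id - phi with phi(x) = x + c, and I = u K[x] with u = 0,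
        deg u <= 1, or u with a repeated root in an algebraic closure *)
  (exists (phi : {lrmorphism {poly K} -> {poly K}}) (c : K) (u : {poly K}),
      (forall p, delta p = p - phi p) /\ phi 'X = 'X + c%:P /\
      (forall p, I p <-> exists q, p = u * q) /\
      (u = 0 \/ (size u <= 2)%N \/ has_repeated_root u))
  ->
  mathieu_subspace (image_of delta I).

Proof.
move=> [[D_der D_nil]|[[phi [deltaE size_phi]]|[phi [c [u [deltaE [phiX [IP u_cases]]]]]]]].
- exact: mathieu_derivation.
- exact: mathieu_expanding deltaE size_phi.
- exact: mathieu_shift deltaE phiX IP u_cases.
Qed.
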